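(* For any positive integer $n$, $p_2(2n)=\frac{n(n+1)}{2}$.
   Context: All graphs are finite and simple. For positive integers $\ell$ and $N$, $p_\ell(N)$ denotes the maximum number of edges in an $N$-vertex graph that contains no two vertices of equal degree connected by a path of length $\ell$ (a path with $\ell$ edges on $\ell+1$ distinct vertices, the two vertices being its endpoints). *)

(* Defs.v *)
From mathcomp Require Import all_boot.

Set Implicit Arguments.
Unset Strict Implicit.
Unset Printing Implicit Defensive.

(* A finite simple graph with vertex type V is given by its edge set: a set   *)
(* of two-element subsets of V.                                               *)
Definition simple_graph (V : finType) (E : {set {set V}}) : bool :=
  [forall e in E, #|e| == 2].

Definition adj (V : finType) (E : {set {set V}}) : rel V :=
  [rel u v | [set u; v] \in E].

Definition degree (V : finType) (E : {set {set V}}) (v : V) : nat :=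
  #|[set e in E | v \in e]|.

(* The vertices of the path are u followed by the l entries of p, so the path *)
(* has l edges.                                                               *)
Definition path_connected (V : finType) (E : {set {set V}}) (l : nat)
    (u v : V) : bool :=
  [exists p : l.-tuple V,
     [&& path (adj E) u p, uniq (u :: p) & last u p == v]].

(* For l = 0 the trivial path joins every vertex to itself; l is meant to be  *)
(* positive, and then joined vertices are distinct.                           *)
Definition no_equal_degree_path (V : finType) (E : {set {set V}}) (l : nat) :
    bool :=
  [forall u : V, forall v : V,
     path_connected E l u v ==> (degree E u != degree E v)].

(* For l > 0 the edgeless graph satisfies the condition, so this is a maximum *)
(* over a nonempty family.                                                    *)
Definition p (l N : nat) : nat :=
  \max_(E : {set {set 'I_N}} | simple_graph E && no_equal_degree_path E l) #|E|.

(* Main.v *)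
Require Import Defs.
From mathcomp Require Import all_boot zify.

Set Implicit Arguments.
Unset Strict Implicit.
Unset Printing Implicit Defensive.

(** The condition says that any two distinct neighbours of a vertex have
    different degrees.  Let [u] have maximum degree [M > 0].  Its [M] neighbours
    have distinct degrees in [1..M], so each of these values occurs exactly once
    and some neighbour [w] of [u] has degree [M] too.  The neighbourhoods of [u]
    and [w] are disjoint, and the degrees over each add up to [M(M+1)/2]; the
    remaining [2n - 2M] vertices have degree at most [M].  Hence twice the number
    of edges is at most [M(M+1) + (2n-2M)M <= n(n+1)], the difference being
    [(n-M)(n-M+1)].  The half graph, with [a_i] joined to [b_j] for [j <= i],
    attains the bound. *)

Lemma gauss_sum n : 2 * (\sum_(1 <= d < n.+1) d) = n * (n + 1).
Proof.
elim: n => [|n IHn]; first by rewrite big_geq.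
by rewrite big_nat_recr //= mulnDr IHn; lia.
Qed.

Lemma card_ord_range N a b : b <= N -> #|[set j : 'I_N | a <= j < b]| = b - a.
Proof.
move=> bN; rewrite -sum1dep_card.
rewrite -(big_mkord (fun j => a <= j < b) (fun=> 1)).
rewrite -(big_nat_widen 0 b N (leq a) (fun=> 1) bN).
by rewrite -(big_nat_widenl a 0 b predT (fun=> 1) (leq0n a)) sum_nat_const_nat muln1.
Qed.

Section Graph.

Variables (V : finType) (E : {set {set V}}).
Hypothesis sE : simple_graph E.

Definition nbrs (v : V) : {set V} := [set w | adj E v w].

Lemma adj_sym u v : adj E u v = adj E v u.
Proof. by rewrite /adj /= setUC. Qed.

Lemma adj_neq u v : adj E u v -> u != v.
Proof.
move=> uv; have /forall_inP/(_ _ uv) := sE.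
by rewrite cards2 eqSS eqb1.
Qed.

(** Sending a neighbour [w] to [[set v; w]] is a bijection onto the edges at [v]; injectivity holds
    because a neighbour differs from [v]. *)
Lemma degree_nbrs v : degree E v = #|nbrs v|.
Proof.
rewrite /degree; have -> : [set e in E | v \in e] =
    [set [set v; w] | w in nbrs v].
  apply/setP=> e; apply/idP/imsetP.
    rewrite inE => /andP[eE ve].
    have /forall_inP/(_ _ eE)/cards2P[x [y [_ ee]]] := sE.
    move: ve; rewrite ee !inE => /orP[]/eqP vE; subst v.
      by exists y => //; rewrite inE /adj /= -ee.
    by exists x; rewrite 1?setUC // inE /adj /= setUC -ee.
  by case=> w + ->; rewrite !inE /adj /= => ->; rewrite eqxx.
rewrite card_in_imset // => x y; rewrite !inE => vx _ /setP/(_ x).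
have := adj_neq vx; rewrite !inE eqxx orbT eq_sym => /negPf->.
by move/esym/eqP.
Qed.

(** Double counting of the incidences between vertices and edges. *)
Lemma sum_degree : \sum_v degree E v = 2 * #|E|.
Proof.
transitivity (\sum_(e in E) \sum_(v in e) 1).
  rewrite (exchange_big_dep predT) //=; apply: eq_bigr => v _.
  by rewrite sum1dep_card.
rewrite mulnC -sum_nat_const; apply: eq_bigr => e eE.
by rewrite sum1_card; have /forall_inP/(_ _ eE)/eqP := sE.
Qed.

(** A path of length 2 is a middle vertex [x] with two distinct neighbours as endpoints. *)
Lemma no_equal_degree_path2P :
  reflect (forall x u v, adj E x u -> adj E x v ->
             degree E u = degree E v -> u = v)
          (no_equal_degree_path E 2).
Proof.
apply: (iffP idP) => [H x u v xu xv duv | H].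
  apply/eqP; apply: contraT => uv.
  move/forallP/(_ u)/forallP/(_ v)/implyP: H; rewrite duv eqxx; apply.
  apply/existsP; exists [tuple x; v] => /=.
  rewrite adj_sym xu xv eqxx !inE !negb_or uv !andbT.
  by rewrite (adj_neq xv) eq_sym (adj_neq xu).
apply/forallP=> u; apply/forallP=> v; apply/implyP=> /existsP[].
case=> [[|x [|y [|]]]] //= _ /and3P[]; rewrite !andbT => /andP[ux xy] + /eqP yv.
subst y; rewrite !inE negb_or => /andP[/andP[_ uv] _].
by apply: contra uv => /eqP duv; apply/eqP/(H x); rewrite // adj_sym.
Qed.

Hypothesis pE : no_equal_degree_path E 2.

(** The [M] degrees are distinct, at most [M], and positive since [u] is adjacent to each neighbour;
    so they exhaust [1..M]. *)
Lemma perm_degree_nbrs (M : nat) u :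
    (forall v, degree E v <= M) -> degree E u = M ->
  perm_eq [seq degree E w | w <- enum (nbrs u)] (iota 1 M).
Proof.
move=> leM uM.
have uniqN : uniq [seq degree E w | w <- enum (nbrs u)].
  rewrite map_inj_in_uniq ?enum_uniq // => x y.
  by rewrite !mem_enum !inE; apply: (no_equal_degree_path2P pE).
have sub : {subset [seq degree E w | w <- enum (nbrs u)] <= iota 1 M}.
  move=> d /mapP[w]; rewrite mem_enum inE => uw ->.
  rewrite mem_iota add1n ltnS leM andbT degree_nbrs card_gt0.
  by apply/set0Pn; exists u; rewrite inE adj_sym.
apply: uniq_perm => //; first exact: iota_uniq.
apply: (uniq_min_size uniqN sub _).2.
by rewrite size_iota size_map -cardE -degree_nbrs uM.
Qed.

Lemma sum_degree_nbrs (M : nat) u :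
    (forall v, degree E v <= M) -> degree E u = M ->
  \sum_(w in nbrs u) degree E w = \sum_(1 <= d < M.+1) d.
Proof.
move=> leM uM; rewrite -big_enum /= -(big_map (degree E) predT id).
by rewrite (perm_big _ (perm_degree_nbrs leM uM)) /index_iota subSS subn0.
Qed.

Lemma card_edges_le n : #|V| = 2 * n -> 2 * #|E| <= n * (n + 1).
Proof.
move=> cV; rewrite -sum_degree.
have [v0 _|V0] := pickP V; last by rewrite big_pred0.
pose M := \max_v degree E v.
have leM v : degree E v <= M by apply: leq_bigmax.
have [u uM] : {u | degree E u = M}.
  have [|u] := @eq_bigmax _ (degree E); first by apply/card_gt0P; exists v0.
  by exists u.
have [M0|Mgt0] := posnP M.
  by rewrite big1 // => v _; have := leM v; rewrite M0; case: degree.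
have [w uw wM] : exists2 w, adj E u w & degree E w = M.
  have : M \in iota 1 M by rewrite mem_iota Mgt0 add1n ltnSn.
  rewrite -(perm_mem (perm_degree_nbrs leM uM)) => /mapP[w].
  by rewrite mem_enum inE => uw ->; exists w.
(* A common neighbour would be the middle of a path joining [u] and [w], both of degree [M]. *)
have dis : [disjoint nbrs u & nbrs w].
  rewrite -setI_eq0; apply/eqP/setP=> x; rewrite !inE; apply/negbTE.
  rewrite !(adj_sym _ x); apply/negP => /andP[xu xw].
  have := adj_neq uw.
  by rewrite ((no_equal_degree_path2P pE) x u w) ?eqxx // uM wM.
have cU : #|nbrs u :|: nbrs w| = 2 * M.
  by rewrite cardsU disjoint_setI0 // cards0 subn0 -!degree_nbrs uM wM; lia.
have cC : 2 * M + #|~: (nbrs u :|: nbrs w)| = 2 * n by rewrite -cU cardsC.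
rewrite (bigID (mem (nbrs u :|: nbrs w))) /=.
under eq_bigl do rewrite in_setU; rewrite bigU //=.
rewrite !(sum_degree_nbrs leM) // addnn -mul2n gauss_sum.
have : \sum_(i | i \notin nbrs u :|: nbrs w) degree E i
         <= #|~: (nbrs u :|: nbrs w)| * M.
  rewrite -sum_nat_const; under [X in _ <= X]eq_bigl do rewrite in_setC.
  by apply: leq_sum.
(* Here [cC] also supplies [M <= n]. *)
nia.
Qed.

End Graph.

Section HalfGraph.

Variable n : nat.

(* The vertex [i < n] is [a_i] and the vertex [n + j] is [b_j]. *)
Definition half_adj (i j : 'I_(2 * n)) := (i < n) && (n <= j <= n + i).

Definition half_graph : {set {set 'I_(2 * n)}} :=
  [set [set x.1; x.2] | x in [set x | half_adj x.1 x.2]].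

Lemma half_graph_simple : simple_graph half_graph.
Proof.
apply/forall_inP=> e /imsetP[[i j]]; rewrite inE /= => ij ->.
rewrite cards2 eqSS eqb1; apply: contraL ij => /eqP->; rewrite /half_adj; lia.
Qed.

Lemma adj_half_graph i j : adj half_graph i j = half_adj i j || half_adj j i.
Proof.
apply/imsetP/orP.
  case=> [[x y]]; rewrite inE /= => xy eq.
  have : x \in [set i; j] by rewrite eq set21.
  have : y \in [set i; j] by rewrite eq set22.
  rewrite !inE => /orP[]/eqP ey /orP[]/eqP ex; subst x y; auto.
    (* The two cases left have [x = y], which [half_adj] excludes. *)
    by move: xy; rewrite /half_adj; lia.
  by move: xy; rewrite /half_adj; lia.
case=> ij; first by exists (i, j); rewrite ?inE.
by exists (j, i); rewrite ?inE //= setUC.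
Qed.

(** The neighbours of [a_i] are [b_0, ..., b_i]; those of [b_j] are [a_j, ..., a_(n-1)]. *)
Lemma degree_half_graph (i : 'I_(2 * n)) :
  degree half_graph i = if i < n then i.+1 else 2 * n - i.
Proof.
rewrite (degree_nbrs half_graph_simple).
case: ifP => lt_in.
  have -> : nbrs half_graph i = [set j : 'I__ | n <= j < n + i.+1].
    by apply/setP=> j; rewrite !inE adj_half_graph /half_adj; lia.
  by rewrite card_ord_range; lia.
have -> : nbrs half_graph i = [set j : 'I__ | i - n <= j < n].
  by apply/setP=> j; rewrite !inE adj_half_graph /half_adj; lia.
by rewrite card_ord_range; have := ltn_ord i; lia.
Qed.

(** All neighbours of a vertex lie on one side, and degrees on one side are pairwise distinct. *)
Lemma half_graph_no_equal_degree_path : no_equal_degree_path half_graph 2.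
Proof.
apply/(no_equal_degree_path2P half_graph_simple) => x u v.
rewrite !adj_half_graph !degree_half_graph /half_adj => xu xv duv; apply: val_inj => /=.
by have := ltn_ord u; have := ltn_ord v; move: duv; case: ifP; case: ifP; lia.
Qed.

Lemma card_half_graph : 2 * #|half_graph| = n * (n + 1).
Proof.
rewrite -(sum_degree half_graph_simple); under eq_bigr do rewrite degree_half_graph.
rewrite -(big_mkord predT (fun i => if i < n then i.+1 else 2 * n - i)).
rewrite (@big_cat_nat _ _ _ n) //=; last by lia.
(* Shifting the second sum by [n] pairs [a_i] with [b_i], whose degrees [i + 1] and [n - i] add up
   to [n + 1]. *)
rewrite -[X in _ + \sum_(X <= _ < _) _]add0n big_addn.
have -> : 2 * n - n = n by lia.
rewrite -big_split /= (eq_big_nat _ _ (F2 := fun=> n + 1)).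
  by rewrite sum_nat_const_nat subn0.
by move=> i /andP[_ lt_in]; rewrite lt_in; case: ifP; lia.
Qed.

End HalfGraph.

Theorem theorem4p3 (n : nat) (hn : 0 < n) : p 2 (2 * n) = (n * (n + 1)) %/ 2.
Proof.
have half m : 2 * m = n * (n + 1) -> m = (n * (n + 1)) %/ 2 by lia.
apply/eqP; rewrite eqn_leq; apply/andP; split.
  apply/bigmax_leqP => E /andP[sE pE].
  by rewrite leq_divRL // mulnC; apply: card_edges_le; rewrite ?card_ord.
rewrite -(half _ (card_half_graph n)); apply: leq_bigmax_cond.
by rewrite half_graph_simple half_graph_no_equal_degree_path.
Qed.
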